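(* Let $p$ and $q$ be distinct rational primes with $p$ odd, let $P$ be a Hurwitz prime of norm $p$ and $Q$ a Hurwitz prime of norm $q$, and let $Q'$, $P'$ be Hurwitz primes of norms $q$ and $p$ respectively with $PQ = Q'P'$. For a Hurwitz prime $R$ of norm $p$ let $t_R$ denote a nonzero trace-zero element of the image of $\mathcal{H}R$ in $\overline{\mathcal{H}} = \mathcal{H}/p\mathcal{H}$ (unique up to scaling). Let $\overline{Q}$ denote the image of $Q$ in $\overline{\mathcal{H}}$. Then $\overline{Q}$ is invertible in $\overline{\mathcal{H}}$, and $t_{P'}$ and $\overline{Q}^{-1} t_P \overline{Q}$ are equal up to scaling by an element of $\mathbb{F}_p^\times$.
   Context: $\mathcal{H}$ is the ring of Hurwitz integers: quaternions $a+bi+cj+dk$ with $a,b,c,d$ all in $\mathbb{Z}$ or all in $\mathbb{Z}+1/2$. Norm: $\mathrm{N}(a+bi+cj+dk)=a^2+b^2+c^2+d^2$; trace: $\operatorname{tr}(a+bi+cj+dk)=2a$. A Hurwitz prime is an irreducible element of $\mathcal{H}$. For odd $p$ and a Hurwitz prime $R$ of norm $p$, the image of $\mathcal{H}R$ in $\mathcal{H}/p\mathcal{H}$ is a two-dimensional $\mathbb{F}_p$-subspace containing a nonzero element of trace zero ($xi+yj+zk$), unique up to scaling. *)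

(* Defs.v *)
From HB Require Import structures.
From mathcomp Require Import all_boot all_order all_algebra.
From mathcomp Require Import ring lra.
From mathcomp Require Import generic_quotient ring_quotient.

Set Implicit Arguments.
Unset Strict Implicit.
Unset Printing Implicit Defensive.

Import Order.TTheory GRing.Theory Num.Theory.
Local Open Scope ring_scope.
Local Open Scope quotient_scope.

(* Quat a b c d is a + b i + c j + d k. *)
Record quat : Type := Quat { qr : rat; qi : rat; qj : rat; qk : rat }.

Definition quat_to_tuple (x : quat) := (qr x, qi x, qj x, qk x).
Definition quat_of_tuple (t : rat * rat * rat * rat) :=
  let: (a, b, c, d) := t in Quat a b c d.
Lemma quat_to_tupleK : cancel quat_to_tuple quat_of_tuple.
Proof. by case. Qed.

HB.instance Definition _ := Countable.copy quat (can_type quat_to_tupleK).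

Lemma quatP (x y : quat) :
  qr x = qr y -> qi x = qi y -> qj x = qj y -> qk x = qk y -> x = y.
Proof. by case: x y => [? ? ? ?] [? ? ? ?] /= -> -> -> ->. Qed.

Definition qadd (x y : quat) :=
  Quat (qr x + qr y) (qi x + qi y) (qj x + qj y) (qk x + qk y).
Definition qopp (x : quat) := Quat (- qr x) (- qi x) (- qj x) (- qk x).
Definition qmul (x y : quat) := Quat
  (qr x * qr y - qi x * qi y - qj x * qj y - qk x * qk y)
  (qr x * qi y + qi x * qr y + qj x * qk y - qk x * qj y)
  (qr x * qj y - qi x * qk y + qj x * qr y + qk x * qi y)
  (qr x * qk y + qi x * qj y - qj x * qi y + qk x * qr y).

Fact qaddA : associative qadd.
Proof. by move=> x y z; apply: quatP => /=; ring. Qed.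
Fact qaddC : commutative qadd.
Proof. by move=> x y; apply: quatP => /=; ring. Qed.
Fact qadd0 : left_id (Quat 0 0 0 0) qadd.
Proof. by move=> x; apply: quatP => /=; ring. Qed.
Fact qaddN : left_inverse (Quat 0 0 0 0) qopp qadd.
Proof. by move=> x; apply: quatP => /=; ring. Qed.
Fact qmulA : associative qmul.
Proof. by move=> x y z; apply: quatP => /=; ring. Qed.
Fact qmul1l : left_id (Quat 1 0 0 0) qmul.
Proof. by move=> x; apply: quatP => /=; ring. Qed.
Fact qmul1r : right_id (Quat 1 0 0 0) qmul.
Proof. by move=> x; apply: quatP => /=; ring. Qed.
Fact qmulDl : left_distributive qmul qadd.
Proof. by move=> x y z; apply: quatP => /=; ring. Qed.
Fact qmulDr : right_distributive qmul qadd.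
Proof. by move=> x y z; apply: quatP => /=; ring. Qed.
Fact qone_neq0 : Quat 1 0 0 0 != Quat 0 0 0 0.
Proof. by []. Qed.

HB.instance Definition _ := GRing.isNzRing.Build quat
  qaddA qaddC qadd0 qaddN qmulA qmul1l qmul1r qmulDl qmulDr qone_neq0.

Definition qnorm (x : quat) : rat :=
  qr x ^+ 2 + qi x ^+ 2 + qj x ^+ 2 + qk x ^+ 2.
Definition qtr (x : quat) : rat := 2%:R * qr x.
Definition qconj (x : quat) := Quat (qr x) (- qi x) (- qj x) (- qk x).

Lemma qnormM (x y : quat) : qnorm (x * y) = qnorm x * qnorm y.
Proof. by rewrite /qnorm /=; ring. Qed.
Lemma qmul_conj (x : quat) : x * qconj x = Quat (qnorm x) 0 0 0.
Proof. by apply: quatP; rewrite /qnorm /=; ring. Qed.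
Lemma qconj_mul (x : quat) : qconj x * x = Quat (qnorm x) 0 0 0.
Proof. by apply: quatP; rewrite /qnorm /=; ring. Qed.

Definition is_hurwitz (x : quat) : bool :=
  [&& qr x \is a Num.int, qi x \is a Num.int,
      qj x \is a Num.int & qk x \is a Num.int]
  || [&& qr x - 2^-1 \is a Num.int, qi x - 2^-1 \is a Num.int,
         qj x - 2^-1 \is a Num.int & qk x - 2^-1 \is a Num.int].

Lemma is_hurwitzP (x : quat) :
  reflect (exists a b c d e : int,
             x = Quat (a%:~R + e%:~R / 2%:R) (b%:~R + e%:~R / 2%:R)
                      (c%:~R + e%:~R / 2%:R) (d%:~R + e%:~R / 2%:R))
          (is_hurwitz x).
Proof.
apply: (iffP orP).
  case=> /and4P[/intrP[a' xa] /intrP[b' xb] /intrP[c' xc] /intrP[d' xd]].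
    by exists a', b', c', d', 0; apply: quatP => /=; rewrite ?mul0r ?addr0.
  exists a', b', c', d', 1.
  by apply: quatP => /=; rewrite -?xa -?xb -?xc -?xd; field.
have h (a e : int) : a%:~R + (2%:R * e%:~R) / 2%:R = (a + e)%:~R :> rat.
  by rewrite rmorphD /=; field.
have h' (a e : int) :
  a%:~R + (2%:R * e%:~R + 1) / 2%:R - 2^-1 = (a + e)%:~R :> rat.
  by rewrite rmorphD /=; field.
case=> a [b [c [d [e ->]]]] /=.
have [f [->|->]] : exists f : int, e = 2%:R * f \/ e = 2%:R * f + 1.
  exists (e %/ 2)%Z; have := divz_eq e 2; rewrite mulrC.
  have := modz_ge0 e (isT : 2%:Z != 0); have := ltz_pmod e (isT : 0 < 2%:Z).
  by case: (e %% 2)%Z => [[|[|?]]|?] // _ _; rewrite ?addr0; [left|right].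
- by left; rewrite rmorphM /= !h !rpred_int.
- by right; rewrite rmorphD rmorphM /= !h' !rpred_int.
Qed.

Lemma is_hurwitz_subring : subring_closed is_hurwitz.
Proof.
split; first by [].
- move=> x y /is_hurwitzP[a [b [c [d [e ->]]]]].
  case/is_hurwitzP=> [a' [b' [c' [d' [e' ->]]]]]; apply/is_hurwitzP.
  exists (a - a'), (b - b'), (c - c'), (d - d'), (e - e').
  by apply: quatP => /=; field.
- move=> x y /is_hurwitzP[a [b [c [d [e ->]]]]].
  case/is_hurwitzP=> [a' [b' [c' [d' [e' ->]]]]]; apply/is_hurwitzP.
  exists (a * a' - b * b' - c * c' - d * d'
          - e * (b' + c' + d') - e' * (b + c + d) - e * e').
  exists (a * b' + b * a' + c * d' - d * c' - e * c' - e' * d).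
  exists (a * c' - b * d' + c * a' + d * b' - e * d' - e' * b).
  exists (a * d' + b * c' - c * b' + d * a' - e * b' - e' * c).
  exists (e * (a' + b' + c' + d') + e' * (a + b + c + d) + e * e').
  by apply: quatP => /=; field.
Qed.

HB.instance Definition _ :=
  GRing.isSubringClosed.Build quat is_hurwitz is_hurwitz_subring.

Record hurwitz : Type := Hurwitz { hval :> quat; hvalP : is_hurwitz hval }.

HB.instance Definition _ := [isSub for hval].
HB.instance Definition _ := [Choice of hurwitz by <:].
HB.instance Definition _ := [SubChoice_isSubNzRing of hurwitz by <:].

Definition hnorm (x : hurwitz) : rat := qnorm x.

(* The trace of a Hurwitz integer is an integer (htrE), so numq only changes
   the type. *)
Definition htr (x : hurwitz) : int := numq (qtr x).

Lemma htrE (x : hurwitz) : (htr x)%:~R = qtr x.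
Proof.
have /is_hurwitzP[a [b [c [d [e ex]]]]] := hvalP x; rewrite /htr /=.
have ->: qtr x = (2%:R * a + e)%:~R by rewrite ex /qtr /=; field.
by rewrite numq_int.
Qed.

Lemma hnorm_nat (x : hurwitz) : exists n : nat, hnorm x = n%:R.
Proof.
apply/natrP; rewrite natrEint; apply/andP; split; last first.
  by rewrite /hnorm /qnorm !addr_ge0 // sqr_ge0.
have /is_hurwitzP[a [b [c [d [e ex]]]]] := hvalP x; apply/intrP.
exists (a ^+ 2 + b ^+ 2 + c ^+ 2 + d ^+ 2 + e * (a + b + c + d) + e ^+ 2).
by rewrite /hnorm ex /qnorm /=; field.
Qed.

Lemma hconj_subproof (x : hurwitz) : is_hurwitz (qconj x).
Proof.
have /is_hurwitzP[a [b [c [d [e ->]]]]] := hvalP x; apply/is_hurwitzP.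
by exists a, (- b - e), (- c - e), (- d - e), e; apply: quatP => /=; field.
Qed.
Definition hconj (x : hurwitz) : hurwitz := Hurwitz (hconj_subproof x).

Lemma hnormM (x y : hurwitz) : hnorm (x * y) = hnorm x * hnorm y.
Proof. exact: qnormM. Qed.

(* The units are the elements of norm 1, for which the inverse is the
   conjugate; hunitP shows that every invertible element is one of them. *)
Definition hunit : pred hurwitz := fun x => hnorm x == 1.
Definition hinv (x : hurwitz) : hurwitz := if hunit x then hconj x else x.

Fact hmulVr : {in hunit, left_inverse 1 hinv *%R}.
Proof.
move=> x hx; rewrite /hinv (hx : hunit x); apply: val_inj.
by rewrite /= qconj_mul -/(hnorm x) (eqP (hx : hunit x)).
Qed.
Fact hmulrV : {in hunit, right_inverse 1 hinv *%R}.
Proof.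
move=> x hx; rewrite /hinv (hx : hunit x); apply: val_inj.
by rewrite /= qmul_conj -/(hnorm x) (eqP (hx : hunit x)).
Qed.
Fact hunitP (x y : hurwitz) : y * x = 1 /\ x * y = 1 -> hunit x.
Proof.
case=> _ xy1; have := hnormM x y; rewrite xy1 {1}/hnorm /qnorm /=.
have [[m mE] [n nE]] := (hnorm_nat x, hnorm_nat y).
rewrite /hunit mE nE -natrM => /eqP.
have ->: 1 ^+ 2 + 0 ^+ 2 + 0 ^+ 2 + 0 ^+ 2 = 1%:R :> rat by [].
by rewrite eqr_nat eq_sym muln_eq1 => /andP[/eqP->].
Qed.
Fact hinv_out : {in [predC hunit], hinv =1 id}.
Proof. by move=> x /negPf hx; rewrite /hinv (hx : hunit x = false). Qed.

HB.instance Definition _ :=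
  GRing.NzRing_hasMulInverse.Build hurwitz hmulVr hmulrV hunitP hinv_out.

Definition hurwitz_prime (x : hurwitz) : Prop :=
  [/\ x != 0, x \isn't a GRing.unit
    & forall a b : hurwitz,
        x = a * b -> a \is a GRing.unit \/ b \is a GRing.unit].

(* Membership in the two-sided ideal p H, decided by dividing by p in the
   rational quaternions; see pidealP. *)
Definition pideal (p : nat) (x : hurwitz) : bool :=
  is_hurwitz (Quat p%:R^-1 0 0 0 * x).

Lemma pidealP (p : nat) (x : hurwitz) :
  (0 < p)%N -> reflect (exists y : hurwitz, x = p%:R * y) (pideal p x).
Proof.
move=> p_gt0; have p0 : p%:R != 0 :> rat by rewrite pnatr_eq0 -lt0n.
have natE : hval p%:R = Quat p%:R 0 0 0.
  elim: p {p_gt0 p0} => [|n IH]; first by apply: quatP.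
  by rewrite -!natr1 /= IH; apply: quatP => /=; rewrite ?addr0.
apply: (iffP idP) => [hx|[y ->]].
  exists (Hurwitz hx); apply: val_inj => /=; rewrite natE.
  by rewrite mulrA; apply: quatP => /=; field.
rewrite /pideal /= natE mulrA.
suff ->: Quat p%:R^-1 0 0 0 * Quat p%:R 0 0 0 = 1 by rewrite mul1r hvalP.
by apply: quatP => /=; field.
Qed.

Lemma pideal_zmod (p : nat) : zmod_closed (pideal p).
Proof.
split=> [|x y hx hy]; rewrite /pideal unfold_in ?mulr0 //=.
by rewrite mulrBr; apply: (rpredB hx hy).
Qed.

HB.instance Definition _ (p : nat) :=
  GRing.isZmodClosed.Build hurwitz (pideal p) (pideal_zmod p).

Lemma pideal_mull p (a x : hurwitz) : x \in pideal p -> a * x \in pideal p.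
Proof.
move=> hx; rewrite unfold_in /pideal /= mulrA.
have ->: Quat p%:R^-1 0 0 0 * hval a = hval a * Quat p%:R^-1 0 0 0.
  by apply: quatP => /=; ring.
by rewrite -mulrA; apply: rpredM; [apply: hvalP | apply: hx].
Qed.
Lemma pideal_mulr p (a x : hurwitz) : x \in pideal p -> x * a \in pideal p.
Proof.
move=> hx; rewrite unfold_in /pideal /= mulrA.
by apply: rpredM; [apply: hx | apply: hvalP].
Qed.

Definition Hbar (p : nat) : Type := 
  Quotient.quot (GRing.ZmodClosed.clone hurwitz (pideal p) _).
HB.instance Definition _ p := GRing.Zmodule.on (Hbar p).
HB.instance Definition _ p := EqQuotient.on (Hbar p).

Section HbarRing.
Variable p : nat.

Definition hbar (x : hurwitz) : Hbar p := \pi_(Hbar p) x.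

Lemma hbar_eq (x y : hurwitz) : (hbar x == hbar y) = (x - y \in pideal p).
Proof. by rewrite Quotient.idealrBE. Qed.

Definition Hbar_mul (x y : Hbar p) : Hbar p := hbar (repr x * repr y).

Lemma hbarM : {morph hbar : x y / x * y >-> Hbar_mul x y}.
Proof.
move=> x y; apply/eqP; rewrite hbar_eq.
set x' := repr _; set y' := repr _.
have hx : x - x' \in pideal p by rewrite -hbar_eq /hbar /x' reprK.
have hy : y - y' \in pideal p by rewrite -hbar_eq /hbar /y' reprK.
rewrite (_ : _ - _ = (x - x') * y + x' * (y - y')); last first.
  by rewrite mulrBl mulrBr addrA subrK.
by apply: rpredD; [apply: pideal_mulr | apply: pideal_mull].
Qed.

Lemma hbarD : {morph hbar : x y / x + y}.
Proof. by move=> x y; rewrite /hbar [LHS]Quotient.pi_add. Qed.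

Lemma hbarK (x : Hbar p) : hbar (repr x) = x. Proof. exact: reprK. Qed.

Fact Hbar_mulA : associative Hbar_mul.
Proof.
by move=> x y z; rewrite -[x]hbarK -[y]hbarK -[z]hbarK -!hbarM mulrA.
Qed.
Fact Hbar_mul1l : left_id (hbar 1) Hbar_mul.
Proof. by move=> x; rewrite -[x]hbarK -!hbarM mul1r. Qed.
Fact Hbar_mul1r : right_id (hbar 1) Hbar_mul.
Proof. by move=> x; rewrite -[x]hbarK -!hbarM mulr1. Qed.
Fact Hbar_mulDl : left_distributive Hbar_mul +%R.
Proof.
move=> x y z; rewrite -[x]hbarK -[y]hbarK -[z]hbarK.
by rewrite -hbarD -!hbarM -hbarD mulrDl.
Qed.
Fact Hbar_mulDr : right_distributive Hbar_mul +%R.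
Proof.
move=> x y z; rewrite -[x]hbarK -[y]hbarK -[z]hbarK.
by rewrite -hbarD -!hbarM -hbarD mulrDr.
Qed.

HB.instance Definition _ := GRing.Zmodule_isPzRing.Build (Hbar p)
  Hbar_mulA Hbar_mul1l Hbar_mul1r Hbar_mulDl Hbar_mulDr.

Fact hbar_is_zmod_morphism : zmod_morphism hbar.
Proof.
move=> x y; apply: (addIr (hbar y)); rewrite subrK -hbarD subrK //.
Qed.
Fact hbar_is_monoid_morphism : monoid_morphism hbar.
Proof. by split => // x y; exact: hbarM. Qed.
HB.instance Definition _ :=
  GRing.isZmodMorphism.Build hurwitz (Hbar p) hbar hbar_is_zmod_morphism.
HB.instance Definition _ :=
  GRing.isMonoidMorphism.Build hurwitz (Hbar p) hbar hbar_is_monoid_morphism.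

(* For p prime, the F_p-vector space structure of the ring Hbar p, which has
   characteristic p (see Fp_scale_nat); here c coerces to its representative in
   {0, ..., p - 1}. *)
Definition Fp_scale (c : 'F_p) (x : Hbar p) : Hbar p := x *+ c.

(* The reduction mod p of the trace (see trbarE). *)
Definition trbar (x : Hbar p) : 'F_p := (htr (repr x))%:~R.

End HbarRing.

Lemma trbarE (p : nat) (x : hurwitz) :
  prime p -> trbar (hbar p x) = (htr x)%:~R.
Proof.
move=> p_pr; have := hbarK (hbar p x); rewrite /trbar; set y := repr _.
move/eqP; rewrite hbar_eq => /(pidealP _ (prime_gt0 p_pr))[z yxz].
have ->: y = x + z *+ p by rewrite -mulr_natl -yxz addrC subrK.
have ->: htr (x + z *+ p) = htr x + htr z *+ p.
  apply: (intr_inj (R := rat)); rewrite rmorphD rmorphMn /= !htrE /qtr /= mulrDr.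
  congr (_ + _); rewrite -mulrnAr; congr (_ * _).
  by elim: (p) => // n IH; rewrite !mulrS -IH.
by rewrite rmorphD rmorphMn /= -mulr_natr pchar_Fp_0 // mulr0 addr0.
Qed.

Lemma Fp_scale_nat (p n : nat) (x : Hbar p) :
  prime p -> Fp_scale n%:R x = x *+ n.
Proof.
move=> p_pr; rewrite /Fp_scale val_Fp_nat // [in RHS](divn_eq n p) mulrnDr.
suff p0 : (p%:R : Hbar p) = 0.
  by rewrite mulnC mulrnA -[x *+ p]mulr_natl p0 mul0r mul0rn add0r.
rewrite -[LHS](rmorph_nat (hbar p)) -(rmorph0 (hbar p)).
apply/eqP; rewrite hbar_eq subr0.
by apply/(pidealP _ (prime_gt0 p_pr)); exists 1; rewrite mulr1.
Qed.

(* t is a nonzero trace-zero element of the image of H R in Hbar p, i.e. a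
   possible value of t_R. *)
Definition is_trace_zero_elt (p : nat) (R : hurwitz) (t : Hbar p) : Prop :=
  [/\ t != 0, trbar t = 0 & exists h : hurwitz, t = hbar p (h * R)].

(* Main.v *)
Require Import Defs.
From mathcomp Require Import all_boot all_order all_algebra.
From mathcomp Require Import ring.
Import GRing.Theory.
Local Open Scope ring_scope.

(** Conjugation by Q maps the trace-zero part of H P to that of H P', because
    conj(Q) h P Q = conj(Q) h Q' P'.  It remains to see that two trace-zero
    elements x, y of the image of H R are proportional when N(R) = p.  Modulo p,
    x conj(y) is a multiple of N(R), hence x y = 0, and then
      tr(h x) y = (h x - x conj(h)) y = - x conj(h) y
                = - x (y h + tr(conj(h) y)) = - tr(conj(h) y) x
    for every h.  Some h has tr(h x) <> 0, since the trace form is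
    nondegenerate modulo an odd p. *)

Lemma quat_nat (n : nat) : n%:R = Quat n%:R 0 0 0.
Proof.
elim: n => [|n IH]; first exact: quatP.
by rewrite -!natr1 IH; apply: quatP => /=; rewrite ?addr0.
Qed.

Lemma hval_nat (n : nat) : hval n%:R = Quat n%:R 0 0 0.
Proof. by rewrite -quat_nat -[hval]/(val) rmorph_nat. Qed.

Lemma hval_intr (m : int) : hval m%:~R = Quat m%:~R 0 0 0.
Proof.
case: m => n; first exact: hval_nat.
rewrite NegzE !mulrNz -[hval]/(val) rmorphN /= -!pmulrn hval_nat.
by apply: quatP; rewrite /= ?oppr0.
Qed.

Lemma hadd_conj (x : hurwitz) : x + hconj x = (htr x)%:~R.
Proof.
by apply: val_inj; rewrite /= hval_intr htrE; apply: quatP; rewrite /= /qtr; ring.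
Qed.

Lemma hconjM (x y : hurwitz) : hconj (x * y) = hconj y * hconj x.
Proof. by apply: val_inj; apply: quatP => /=; ring. Qed.

Lemma hconjK (x : hurwitz) : hconj (hconj x) = x.
Proof. by apply: val_inj; apply: quatP => /=; ring. Qed.

Lemma hmul_conj_nat (x : hurwitz) (n : nat) :
  hnorm x = n%:R -> x * hconj x = n%:R.
Proof.
move=> nx; apply: val_inj; rewrite /= qmul_conj -/(hnorm x) nx.
by rewrite hval_nat.
Qed.

Lemma hconj_mul_nat (x : hurwitz) (n : nat) :
  hnorm x = n%:R -> hconj x * x = n%:R.
Proof.
move=> nx; apply: val_inj; rewrite /= qconj_mul -/(hnorm x) nx.
by rewrite hval_nat.
Qed.

(** The trace is cyclic, so tr(conj(x) z x) = tr(z x conj(x)) = N(x) tr(z). Hence conjugation by Q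
    preserves trace zero; the factor [m] leaves room for an inverse of N(Q) modulo p. *)
Lemma htr_conjugate (x z : hurwitz) (m n : nat) :
  hnorm x = n%:R -> htr (m%:R * (hconj x * (z * x))) = (m * n)%:Z * htr z.
Proof.
move=> nx; apply: (intr_inj (R := rat)); rewrite rmorphM /= !htrE PoszM rmorphM /=.
by rewrite -!pmulrn -nx hval_nat /hnorm /qnorm /qtr /=; ring.
Qed.

Definition hi : hurwitz := @Hurwitz (Quat 0 1 0 0) isT.
Definition hj : hurwitz := @Hurwitz (Quat 0 0 1 0) isT.
Definition hk : hurwitz := @Hurwitz (Quat 0 0 0 1) isT.

(** The basis 1, i, j, k is orthogonal for the form tr(h x), with squares 2, -2, -2, -2; this
    accounts for the factor 2 and the signs. *)
Lemma hdouble_trace (x : hurwitz) :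
  x *+ 2 = (htr (1 * x))%:~R - hi * (htr (hi * x))%:~R
           - hj * (htr (hj * x))%:~R - hk * (htr (hk * x))%:~R.
Proof.
apply: val_inj; rewrite /= !hval_intr !htrE.
by apply: quatP; rewrite /= /qtr /=; ring.
Qed.

Section ModuloP.
Variables (p : nat) (p_prime : prime p).

Lemma Hbar_natp : (p%:R : Hbar p) = 0.
Proof. by rewrite -(Fp_scale_nat p 1 p_prime) /Fp_scale pchar_Fp_0. Qed.

Lemma Hbar_mulrnp (x : Hbar p) : x *+ p = 0.
Proof. by rewrite -mulr_natl Hbar_natp mul0r. Qed.

Lemma Fp_scale_int (m : int) (x : Hbar p) : Fp_scale m%:~R x = x *~ m.
Proof.
have [n [k mE]] : exists n k : nat, m + (k * p)%:Z = n%:Z.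
  case: m => n; first by exists n, 0%N; rewrite mul0n addr0.
  (* The negative integer -(n+1) is shifted by (n+1) p, which makes it nonnegative since p is
     positive. *)
  exists (n.+1 * p - n.+1)%N, n.+1; rewrite NegzE addrC subzn //.
  by rewrite leq_pmulr // prime_gt0.
have -> : x *~ m = x *+ n.
  by rewrite pmulrn -mE mulrzDr -pmulrn mulnC mulrnA Hbar_mulrnp mul0rn addr0.
suff -> : (m%:~R : 'F_p) = n%:R by exact: Fp_scale_nat.
by rewrite [RHS]pmulrn -mE rmorphD /= -pmulrn natrM pchar_Fp_0 // mulr0 addr0.
Qed.

Lemma Fp_scaleA (a b : 'F_p) (x : Hbar p) :
  Fp_scale a (Fp_scale b x) = Fp_scale (a * b) x.
Proof.
rewrite -[in RHS](natr_Zp a) -[in RHS](natr_Zp b) -natrM Fp_scale_nat //.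
by rewrite /Fp_scale -mulrnA mulnC.
Qed.

Lemma Fp_scale1 (x : Hbar p) : Fp_scale 1 x = x.
Proof. exact: (Fp_scale_nat 1 x p_prime). Qed.

Lemma Hbar_intr_eq0 (m : int) : m%:~R = 0 :> 'F_p -> m%:~R = 0 :> Hbar p.
Proof. by move=> m0; rewrite -Fp_scale_int m0. Qed.

(** If 1, i, j and k all fail as [h], then [hdouble_trace] gives 2x = 0 modulo p. *)
Lemma htr_nondegenerate (x : hurwitz) :
  odd p -> hbar p x != 0 ->
  exists h : hurwitz, (htr (h * x))%:~R != 0 :> 'F_p.
Proof.
move=> p_odd /eqP x0.
pose T h := ((htr (h * x))%:~R : 'F_p).
have [/eqP T1|] := boolP (T 1 == 0); last by exists 1.
have [/eqP Ti|] := boolP (T hi == 0); last by exists hi.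
have [/eqP Tj|] := boolP (T hj == 0); last by exists hj.
have [/eqP Tk|] := boolP (T hk == 0); last by exists hk.
case: x0; have x2 : hbar p x *+ 2 = 0.
  rewrite -rmorphMn hdouble_trace !rmorphB !rmorphM /= !rmorph_int.
  by rewrite !Hbar_intr_eq0 // !mulr0 !subr0.
(* As p is odd, 0 = p x = x + (p - 1)/2 (2x) = x. *)
have pE : p = (1 + 2 * p./2)%N by rewrite mul2n -[LHS]odd_double_half p_odd.
rewrite -(Hbar_mulrnp (hbar p x)) [X in _ *+ X]pE.
by rewrite mulrnDr mulrnA x2 mul0rn addr0.
Qed.

Lemma hbar_conj (x : hurwitz) :
  hbar p (hconj x) = (htr x)%:~R - hbar p x.
Proof. by rewrite -(rmorph_int (hbar p)) -hadd_conj rmorphD addrC addKr. Qed.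

(** Trace zero means conj(x) = -x modulo p, so tr(h x) = h x + conj(x) conj(h) = h x - x conj(h). *)
Lemma htr_mul_trace_zero (h x : hurwitz) :
  (htr x)%:~R = 0 :> 'F_p ->
  (htr (h * x))%:~R = hbar p h * hbar p x - hbar p x * hbar p (hconj h).
Proof.
move=> /Hbar_intr_eq0 trx; rewrite [RHS]addrC -mulNr.
have -> : - hbar p x = hbar p (hconj x) by rewrite hbar_conj trx sub0r.
by rewrite -!rmorphM /= -hconjM hbar_conj subrK.
Qed.

Lemma trace_zero_elt_proportional (R : hurwitz) (t u : Hbar p) :
  odd p -> hnorm R = p%:R ->
  is_trace_zero_elt R t -> is_trace_zero_elt R u ->
  exists2 c : 'F_p, c != 0 & u = Fp_scale c t.
Proof.
move=> p_odd nR [t0 trt [a tE]] [u0 tru [b uE]].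
set x := a * R in tE; set y := b * R in uE; subst t u.
rewrite !trbarE // in trt tru.
(* Here x conj(y) = a R conj(R) conj(b) = p a conj(b), and conj(y) = -y modulo p. *)
have xy0 : hbar p x * hbar p y = 0.
  apply: oppr_inj; rewrite oppr0 -mulrN.
  have -> : - hbar p y = hbar p (hconj y).
    by rewrite hbar_conj (Hbar_intr_eq0 _ tru) sub0r.
  rewrite -rmorphM /x /y hconjM mulrA -(mulrA a) (hmul_conj_nat _ _ nR).
  by rewrite !rmorphM /= rmorph_nat Hbar_natp mulr0 mul0r.
have [h Th] := htr_nondegenerate x p_odd t0.
set T := htr (h * x) in Th; pose S := htr (hconj h * y).
have TE := htr_mul_trace_zero h _ trt; have SE := htr_mul_trace_zero (hconj h) _ tru.
rewrite hconjK -/S in SE; rewrite -/T in TE.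
(* Since x y = 0, both sides equal -x conj(h) y. *)
have yx : hbar p y *~ T = hbar p x *~ (- S).
  rewrite -mulrzl TE mulrBl -!mulrA xy0 mulr0 sub0r mulrNz.
  by rewrite -[in RHS]mulrzr SE mulrBr (mulrA (hbar p x) (hbar p y)) xy0 mul0r subr0.
have yE : hbar p y = Fp_scale (T%:~R^-1 * (- S)%:~R) (hbar p x).
  by rewrite -Fp_scaleA Fp_scale_int -yx -Fp_scale_int Fp_scaleA mulVf ?Fp_scale1.
exists (T%:~R^-1 * (- S)%:~R) => //.
by apply: contraNneq u0 => c0; rewrite yE c0.
Qed.

End ModuloP.

Theorem theorem3p1 (p q : nat) (P Q Q' P' : hurwitz)
    (p_prime : prime p) (q_prime : prime q) (p_neq_q : p != q) (p_odd : odd p)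
    (P_prime : hurwitz_prime P) (normP : hnorm P = p%:R)
    (Q_prime : hurwitz_prime Q) (normQ : hnorm Q = q%:R)
    (Q'_prime : hurwitz_prime Q') (normQ' : hnorm Q' = q%:R)
    (P'_prime : hurwitz_prime P') (normP' : hnorm P' = p%:R)
    (PQ_eq : P * Q = Q' * P') :
  exists Qinv : Hbar p,
    [/\ Qinv * hbar p Q = 1,
        hbar p Q * Qinv = 1
      & forall tP tP' : Hbar p,
          is_trace_zero_elt P tP -> is_trace_zero_elt P' tP' ->
          exists2 c : 'F_p, c != 0 & tP' = Fp_scale c (Qinv * tP * hbar p Q)].
Proof.
have q0 : (q%:R : 'F_p) != 0.
  by rewrite -(dvdn_pcharf (pchar_Fp p_prime)) dvdn_prime2.
(* A natural number inverting N(Q) = q modulo p, so that [n] conj(Q) inverts Q there. *)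
pose n : nat := (q%:R^-1 : 'F_p).
have nq : (n%:R * q%:R : Hbar p) = 1.
  by rewrite -natrM -(Fp_scale_nat _ 1 p_prime) natrM natr_Zp mulVf.
pose Qinv := hbar p (n%:R * hconj Q).
have QinvQ : Qinv * hbar p Q = 1.
  by rewrite -rmorphM -mulrA (hconj_mul_nat _ _ normQ) rmorphM /= !rmorph_nat.
have QQinv : hbar p Q * Qinv = 1.
  rewrite -rmorphM /= mulrA mulr_natr -mulr_natl -mulrA.
  by rewrite (hmul_conj_nat _ _ normQ) rmorphM /= !rmorph_nat.
exists Qinv; split=> // tP tP' [tP0 trP [h hE]].
have sE : Qinv * tP * hbar p Q = hbar p (n%:R * (hconj Q * (h * P * Q))).
  by rewrite hE /Qinv !rmorphM /= !mulrA.
apply: trace_zero_elt_proportional => //; split.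
(* Conjugating back, [tP] = Q ([Qinv] [tP] Q) [Qinv], which would vanish with the conjugate. *)
- apply: contraNneq tP0 => s0; apply/eqP.
  by rewrite -[tP]mul1r -[_ * tP]mulr1 -QQinv mulrA -2!(mulrA (hbar p Q))
             s0 mulr0 mul0r.
- rewrite sE trbarE // (htr_conjugate _ _ _ _ normQ) rmorphM /=.
  by move: trP; rewrite hE trbarE // => ->; rewrite mulr0.
(* The left multiplier of P' comes from replacing P Q by Q' P' in [n] conj(Q) h P Q. *)
- exists (n%:R * hconj Q * h * Q').
  by rewrite sE -!mulrA PQ_eq.
Qed.
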